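(* Let $h(x)=-x\log_2 x-(1-x)\log_2(1-x)$ denote the binary entropy function, and let $\alpha_0\in(0,1/2)$ be the unique solution of $h(\alpha_0)=1/3$. Set $c_0=1/(3\alpha_0)$ (so that $c_0\approx 5.42$). Then every connected cographic matroid $M$ not isomorphic to $U_{1,1}$ satisfies $\eta(M)\le c_0\,\mu(M)$.
   Context: Matroids are finite, and connected matroids are understood to have nonempty ground set. $U_{1,1}$ is the one-element rank-$1$ uniform matroid. A matroid is cographic if it is the dual $M^*(G)$ of the graphic matroid of some graph $G$. A join of a matroid $M$ on ground set $E(M)$ is a set $J\subseteq E(M)$ with $|J\cap C|\le |C|/2$ for every circuit $C$ of $M$. $\mu(M)$ is the maximum size of a join. Ear decompositions: for a nonempty sequence of circuits $C_1,\dots,C_t$ of $M$ put $D_0=\varnothing$ and $D_i=C_1\cup\dots\cup C_i$. The sequence is an ear decomposition of $M$ if $D_t=E(M)$ and for every $i\ge 2$: (E1) $C_i\cap D_{i-1}\neq\varnothing$; (E2) $C_i\setminus D_{i-1}\ne\varnothing$; (E3) no circuit $C$ of $M$ with $C\cap D_{i-1}\neq\varnothing$ and $C\setminus D_{i-1}\neq\varnothing$ has $C\setminus D_{i-1}$ properly contained in $C_i\setminus D_{i-1}$. The set $P_i=C_i\setminus D_{i-1}$ is the $i$th lobe; it is odd or even according to the parity of $|P_i|$. $\varphi(M)$ is the minimum number of even lobes over all ear decompositions of $M$. For a connected matroid $M$ not isomorphic to $U_{1,1}$, an ear decomposition exists, and $\eta(M):=\frac{r(M)+\varphi(M)}{2}$,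 where $r(M)$ is the rank. *)

(* Defs.v *)
From mathcomp Require Import all_boot all_order all_algebra.
From mathcomp Require Import boolp reals exp.

Set Implicit Arguments.
Unset Strict Implicit.
Unset Printing Implicit Defensive.

Import Order.TTheory GRing.Theory Num.Theory.

(* The ground set of a matroid is the whole of a finite type E; an arbitrary
   finite ground set is covered since E is arbitrary. *)
Record matroid (E : finType) := Matroid {
  indep : {set {set E}};
  indep0 : set0 \in indep;
  indepS : forall I J : {set E}, I \subset J -> J \in indep -> I \in indep;
  indep_aug : forall I J : {set E}, I \in indep -> J \in indep -> #|I| < #|J| ->
    exists2 x, x \in J :\: I & x |: I \in indep
}.

Section MatroidNotions.

Variables (E : finType) (M : matroid E).
Implicit Types (A B C I J : {set E}) (Cs : seq {set E}).

Definition circuit C := minset (fun A => A \notin indep M) C.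

Definition base B := maxset (fun A => A \in indep M) B.

Definition rank := \max_(I in indep M) #|I|.

Definition matroid_connected :=
  0 < #|E| /\
  forall x y : E, x != y -> exists C, [/\ circuit C, x \in C & y \in C].

Definition join J := [forall (C | circuit C), 2 * #|J :&: C| <= #|C|].

Definition matroid_mu := \max_(J | join J) #|J|.

(* Sequences are indexed from 0: the i-th circuit of the mathematical
   C_1, ..., C_t is [nth set0 Cs i.-1], and [ear_union Cs i] is D_i. *)
Definition ear_union Cs i := \bigcup_(C <- take i Cs) C.

Definition lobe Cs i := nth set0 Cs i :\: ear_union Cs i.

Definition ear_decomposition Cs :=
  [/\ Cs != [::], all circuit Cs, ear_union Cs (size Cs) = [set: E] &
   forall i, 0 < i < size Cs ->
     [/\ nth set0 Cs i :&: ear_union Cs i != set0,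
         lobe Cs i != set0 &
         forall C, circuit C ->
           C :&: ear_union Cs i != set0 -> C :\: ear_union Cs i != set0 ->
           ~~ (C :\: ear_union Cs i \proper lobe Cs i)]].

Definition even_lobes Cs :=
  count (fun i => ~~ odd #|lobe Cs i|) (iota 0 (size Cs)).

Definition has_even_lobes k :=
  `[< exists2 Cs, ear_decomposition Cs & even_lobes Cs = k >].

(* The value is 0 by convention when M has no ear decomposition. *)
Definition matroid_phi : nat :=
  if pselect (exists k, has_even_lobes k) is left h then ex_minn h else 0.

Lemma matroid_phiP :
  (exists Cs, ear_decomposition Cs) ->
  (exists2 Cs, ear_decomposition Cs & even_lobes Cs = matroid_phi) /\
  (forall Cs, ear_decomposition Cs -> matroid_phi <= even_lobes Cs).
Proof.
case=> Cs0 ed0; rewrite /matroid_phi.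
case: pselect => [h|[]]; last by exists (even_lobes Cs0); apply/asboolP; exists Cs0.
case: ex_minnP => k /asboolP hk kmin; split=> // Cs ed.
by apply: kmin; apply/asboolP; exists Cs.
Qed.

Lemma indep_base_ext I B : I \in indep M -> base B ->
  exists B1, [/\ base B1, I \subset B1 & B1 \subset I :|: B].
Proof.
move=> iI /maxsetP[iB maxB].
pose P := fun J => [&& J \in indep M, I \subset J & J \subset I :|: B].
have PI : P I by rewrite /P iI subxx subsetUl.
have [J /maxsetP[/and3P[iJ sIJ sJ] maxJ] _] := maxset_exists PI.
have leBJ : #|B| <= #|J|.
  rewrite leqNgt; apply/negP => /(indep_aug iJ iB)[x].
  rewrite inE => /andP[xJ xB] ixJ.
  have PxJ : P (x |: J).
    rewrite /P ixJ (subset_trans sIJ (subsetUr _ _)) subUset sJ andbT.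
    by rewrite sub1set inE xB orbT.
  by move: xJ; rewrite -(maxJ _ PxJ (subsetUr _ _)) setU11.
exists J; split=> //; apply/maxsetP; split=> // K iK sJK.
apply/eqP; rewrite eq_sym eqEcard sJK /= (leq_trans _ leBJ) // leqNgt.
apply/negP => /(indep_aug iB iK)[x]; rewrite inE => /andP[xB _] ixB.
by move: xB; rewrite -(maxB _ ixB (subsetUr _ _)) setU11.
Qed.

Lemma base_card_max I B : I \in indep M -> base B -> #|I| <= #|B|.
Proof.
move=> iI /maxsetP[iB maxB]; rewrite leqNgt.
apply/negP => /(indep_aug iB iI)[x]; rewrite inE => /andP[xB _] ixB.
by move: xB; rewrite -(maxB _ ixB (subsetUr _ _)) setU11.
Qed.

(* The bases of the dual are the complements of the bases. *)
Definition dual_indep : {set {set E}} :=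
  [set A : {set E} | [exists B : {set E}, base B && (A \subset ~: B)]].

Fact dual_indep0 : set0 \in dual_indep.
Proof.
have [B mB _] := maxset_exists (P := fun A => A \in indep M) (indep0 M).
by rewrite inE; apply/existsP; exists B; rewrite /base mB sub0set.
Qed.

Fact dual_indepS I J : I \subset J -> J \in dual_indep -> I \in dual_indep.
Proof.
move=> sIJ; rewrite !inE => /existsP[B /andP[bB sJ]].
by apply/existsP; exists B; rewrite bB (subset_trans sIJ).
Qed.

Fact dual_indep_aug I J : I \in dual_indep -> J \in dual_indep ->
  #|I| < #|J| -> exists2 x, x \in J :\: I & x |: I \in dual_indep.
Proof.
rewrite !inE => /existsP[B /andP[bB sIB]] /existsP[B' /andP[bB' sJB']] ltIJ.
have iD : B' :\: I \in indep M.
  by case/maxsetP: bB' => iB' _; apply: indepS iB'; apply: subsetDl.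
have [B1 [bB1 sD1 sB1]] := indep_base_ext iD bB.
have dB1I : I \subset ~: B1.
  apply/subsetP=> x xI; rewrite inE; apply/negP => /(subsetP sB1).
  rewrite !inE xI /= => xB; move/subsetP/(_ x xI): sIB.
  by rewrite inE xB.
have [sJ1|] := boolP (J :\: I \subset B1); last first.
  case/subsetPn=> x xJ xB1; exists x => //.
  rewrite inE; apply/existsP; exists B1; rewrite bB1 subUset dB1I andbT.
  by rewrite sub1set inE.
exfalso.
have le1 : #|B1| <= #|B'|.
  by apply: base_card_max => //; case/maxsetP: bB1.
have dj1 : (B' :\: I) :&: (J :\: I) = set0.
  apply/setP=> x; rewrite !inE; apply/negP.
  case/andP=> /andP[_ xB'] /andP[_ xJ].
  by move/subsetP/(_ x xJ): sJB'; rewrite inE xB'.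
have dj2 : (B' :&: I) :&: (J :&: I) = set0.
  apply/setP=> x; rewrite !inE; apply/negP.
  case/andP=> /andP[xB' _] /andP[xJ _].
  by move/subsetP/(_ x xJ): sJB'; rewrite inE xB'.
have le2 : #|B' :\: I| + #|J :\: I| <= #|B1|.
  by rewrite -cardsUI dj1 cards0 addn0 subset_leq_card // subUset sD1.
have le3 : #|B' :&: I| + #|J :&: I| <= #|I|.
  by rewrite -cardsUI dj2 cards0 addn0 subset_leq_card // subUset !subsetIr.
have := leq_add le2 le3; rewrite addnACA ![#|_ :\: _| + _]addnC !cardsID.
move=> h; have := leq_trans h (leq_add le1 (leqnn #|I|)).
by rewrite leq_add2l leqNgt ltIJ.
Qed.

Definition dual : matroid E := Matroid dual_indep0 dual_indepS dual_indep_aug.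

End MatroidNotions.

Definition matroid_iso (E1 E2 : finType) (M1 : matroid E1) (M2 : matroid E2) :=
  exists2 f : E1 -> E2, bijective f &
    forall A : {set E1}, (f @: A \in indep M2) = (A \in indep M1).

Section Uniform.

Variables (r n : nat).

Definition uniform_indep := [set A : {set 'I_n} | #|A| <= r].

Fact uniform_indep0 : set0 \in uniform_indep.
Proof. by rewrite inE cards0. Qed.

Fact uniform_indepS (I J : {set 'I_n}) :
  I \subset J -> J \in uniform_indep -> I \in uniform_indep.
Proof. by rewrite !inE => /subset_leq_card; apply: leq_trans. Qed.

Fact uniform_indep_aug (I J : {set 'I_n}) :
  I \in uniform_indep -> J \in uniform_indep -> #|I| < #|J| ->
  exists2 x, x \in J :\: I & x |: I \in uniform_indep.
Proof.
rewrite !inE => _ leJ ltIJ.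
have /subsetPn[x xJ xI] : ~~ (J \subset I).
  by apply: contraL ltIJ => /subset_leq_card; rewrite -leqNgt.
exists x; first by rewrite inE xI.
by rewrite inE cardsU1 xI add1n (leq_trans ltIJ).
Qed.

Definition uniform : matroid 'I_n :=
  Matroid uniform_indep0 uniform_indepS uniform_indep_aug.

End Uniform.

(* Undirected multigraphs, with loops and parallel edges allowed; the order of
   the two ends of an edge is irrelevant, see [joins]. *)
Record graph := Graph {
  vertex : finType;
  edge : finType;
  ends : edge -> vertex * vertex
}.

Section CycleMatroid.

Variable G : graph.
Let V := vertex G.
Let F := edge G.
Implicit Types (A I J : {set F}) (e f g : F) (x y : V).

Definition joins e x y := (ends e == (x, y)) || (ends e == (y, x)).

(* Edge set of a cycle with k.+1 distinct vertices and edges, [ordS] being the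
   cyclic successor; a loop is a cycle with k = 0, and two parallel edges form
   a cycle with k = 1. *)
Definition is_cycle A :=
  exists k (v : 'I_k.+1 -> V) (c : 'I_k.+1 -> F),
    [/\ injective v, injective c,
        forall i, joins (c i) (v i) (v (ordS i)) &
        A = [set c i | i : 'I_k.+1]].

Definition acyclic A := forall C : {set F}, is_cycle C -> ~~ (C \subset A).

Definition cycle_indep : {set {set F}} := [set A : {set F} | `[< acyclic A >]].

Definition adj A : rel V := fun x y => [exists e in A, joins e x y].

Let conn A := connect (adj A).

Lemma joinsC e x y : joins e x y = joins e y x.
Proof. by rewrite /joins orbC. Qed.

Lemma joins_ends e : joins e (ends e).1 (ends e).2.
Proof. by rewrite /joins -surjective_pairing eqxx. Qed.

Lemma adjP A x y : reflect (exists2 e, e \in A & joins e x y) (adj A x y).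
Proof. exact: exists_inP. Qed.

Lemma conn_sym A : symmetric (conn A).
Proof.
apply: symmetric_from_pre => x y.
have s : symmetric (adj A).
  by move=> a b; apply: eq_existsb => e; rewrite joinsC.
by rewrite /conn (sym_connect_sym s).
Qed.

Lemma conn_joins A e x y z t :
  joins e x y -> joins e z t -> conn A x y = conn A z t.
Proof.
rewrite /joins => /orP[]/eqP-> /orP[]/eqP[-> ->] //; exact: conn_sym.
Qed.

Lemma conn_sub A I : (forall e, e \in A -> conn I (ends e).1 (ends e).2) ->
  forall x y, conn A x y -> conn I x y.
Proof.
move=> h; apply: connect_sub => x y /adjP[e eA je].
by rewrite -/(conn I x y) (conn_joins I je (joins_ends e)) h.
Qed.

Lemma acyclic_sub I J : I \subset J -> acyclic J -> acyclic I.
Proof. by move=> s a C /a; apply: contra => /subset_trans; apply. Qed.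

Lemma acyclic_add A e : acyclic A -> ~~ conn A (ends e).1 (ends e).2 ->
  acyclic (e |: A).
Proof.
move=> aA ne C cC; apply/negP => sC.
have eC : e \in C.
  apply: contraT => eC; have := aA _ cC.
  suff -> : C \subset A by [].
  apply/subsetP => f fC; have := subsetP sC _ fC.
  by rewrite !inE; case: eqP => // fe; rewrite fe (negbTE eC) in fC.
case: cC => k [v [c [injv injc jc defC]]].
move: eC; rewrite defC => /imsetP[j _ ej].
case/negP: ne; rewrite -(conn_joins A (jc j)) ?ej ?joins_ends // conn_sym.
have itS m : iter m (@ordS k.+1) (ordS j) = (j + m.+1) %% k.+1 :> nat.
  elim: m => [|m IH]; first by rewrite /= addn1.
  by rewrite iterS /= IH -addn1 modnDml addn1 -addnS.
have step m : m <= k -> conn A (v (ordS j)) (v (iter m (@ordS k.+1) (ordS j))).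
  elim: m => [|m IH] lemk; first exact: connect0.
  apply: connect_trans (IH (ltnW lemk)) _; apply: connect1.
  set i := iter m _ _; apply/adjP; exists (c i); last by rewrite iterS jc.
  have : c i \in e |: A by apply: (subsetP sC); rewrite defC imset_f.
  rewrite !inE ej => /orP[/eqP/injc|//] /(congr1 val)/= /eqP.
  rewrite itS -{2}(modn_small (ltn_ord j)) -{2}[nat_of_ord j]addn0 eqn_modDl.
  by rewrite mod0n modn_small.
have := step k (leqnn k); suff <- : j = iter k (@ordS k.+1) (ordS j) by [].
by apply: ord_inj; rewrite itS modnDr modn_small.
Qed.

Lemma acyclic_del A e : acyclic A -> e \in A ->
  ~~ conn (A :\ e) (ends e).1 (ends e).2.
Proof.
move=> aA eA; apply/negP => /connectP[p0].
set x := (ends e).1 => pp0 lp0; move: pp0 lp0 => /shortenP[p pp up _] lp.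
set k := size p; pose w := nth x (x :: p).
have injw a b : a <= k -> b <= k -> w a = w b -> a = b.
  by move=> ha hb /eqP; rewrite nth_uniq //= => /eqP.
have adjw a : a < k -> exists2 g, g \in A :\ e & joins g (w a) (w a.+1).
  by move=> ak; apply/adjP; apply: (pathP x pp).
pose ce a := odflt e [pick g in A :\ e | joins g (w a) (w a.+1)].
have ceP a : a < k -> ce a \in A :\ e /\ joins (ce a) (w a) (w a.+1).
  move=> /adjw[g gA jg]; rewrite /ce; case: pickP => [h /andP[]//|/(_ g)].
  by rewrite gA jg.
pose v (i : 'I_k.+1) := w i.
pose c (i : 'I_k.+1) := if (i : nat) < k then ce i else e.
suff cyc : is_cycle [set c i | i : 'I_k.+1].
  have := aA _ cyc; apply/negP/negPn; apply/subsetP => _ /imsetP[i _ ->].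
  rewrite /c; case: ifP => // /ceP[]; by rewrite !inE => /andP[].
exists k, v, c; split=> //.
- move=> i j /injw h; apply/val_inj/h; by rewrite -ltnS.
- move=> i j; rewrite /c; case: ltnP => hi; case: ltnP => hj.
  + have [_ ji] := ceP _ hi; have [_ jj] := ceP _ hj => eij.
    move: ji jj; rewrite eij /joins.
    case/orP=> /eqP-> /orP[]/eqP[] /injw h1 /injw h2; apply: val_inj => /=.
    * by apply: h1; apply: ltnW.
    * have e1 := h1 (ltnW hi) hj; have e2 := h2 hi (ltnW hj).
      by move: (ltnn j); rewrite -{2}e2 e1 ltnS leqnSn.
    * have e1 := h1 hi (ltnW hj); have e2 := h2 (ltnW hi) hj.
      by move: (ltnn j); rewrite -{2}e1 e2 ltnS leqnSn.
    * by apply/eqP; rewrite -eqSS; apply/eqP; apply: h1.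
  + by have [+ _] := ceP _ hi => /[swap] ->; rewrite !inE eqxx.
  + by have [+ _] := ceP _ hj => /[swap] <-; rewrite !inE eqxx.
  + move=> _; apply: val_inj => /=; apply: (@anti_leq i j).
    by rewrite (leq_trans _ hj) ?(leq_trans _ hi) // -ltnS.
- move=> i; rewrite /c /v /=; case: ltnP => hi.
    by rewrite modn_small //; case: (ceP _ hi).
  have -> : i = k :> nat by apply/eqP; rewrite eqn_leq hi -ltnS ltn_ord.
  rewrite modnn /= joinsC /w nth_last /= -lp; exact: joins_ends.
Qed.

Lemma acyclic_span_card I J : acyclic J ->
  (forall e, e \in J -> conn I (ends e).1 (ends e).2) -> #|J| <= #|I|.
Proof.
have [n] := ubnP #|J :\: I|; elim: n J => // n IH J ltn aJ spJ.
have [sJI|] := boolP (J \subset I); first exact: subset_leq_card.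
case/subsetPn=> f fJ fI; have nf := acyclic_del aJ fJ.
have [g gI ng] : exists2 g, g \in I & ~~ conn (J :\ f) (ends g).1 (ends g).2.
  apply/exists_inP; apply: contraNT nf; rewrite negb_exists_in => /forall_inP h.
  by apply: conn_sub (spJ f fJ) => e /h; rewrite negbK.
have gJf : g \notin J :\ f.
  apply: contra ng => gJ; apply: connect1; apply/adjP; exists g => //.
  exact: joins_ends.
have cJ : #|g |: (J :\ f)| = #|J| by rewrite cardsU1 gJf [#|J|](cardsD1 f) fJ.
rewrite -cJ; apply: IH; last 2 first.
- by apply: acyclic_add => //; apply: acyclic_sub aJ; apply: subD1set.
- move=> e; rewrite !inE => /orP[/eqP->|/andP[_ /spJ//]].
  by apply: connect1; apply/adjP; exists g => //; apply: joins_ends.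
apply: leq_trans (_ : #|J :\: I| <= n); last by rewrite -ltnS.
apply: proper_card; apply/properP; split.
  apply/subsetP=> e; rewrite !inE => /andP[eI /orP[/eqP eg|/andP[_ ->]]].
    by rewrite eg gI in eI.
  by rewrite eI.
exists f; first by rewrite inE fI.
rewrite !inE eqxx fI /= orbF; apply: contra fI => /eqP->; exact: gI.
Qed.

Fact cycle_indep0 : set0 \in cycle_indep.
Proof.
rewrite inE; apply/asboolP => _ [k [v [c [_ _ _ ->]]]].
by apply/negP => /subsetP/(_ (c ord0)); rewrite imset_f // inE => /(_ isT).
Qed.

Fact cycle_indepS I J : I \subset J -> J \in cycle_indep -> I \in cycle_indep.
Proof. by rewrite !inE => s /asboolP h; apply/asboolP/(acyclic_sub s). Qed.

Fact cycle_indep_aug I J : I \in cycle_indep -> J \in cycle_indep ->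
  #|I| < #|J| -> exists2 x, x \in J :\: I & x |: I \in cycle_indep.
Proof.
rewrite !inE => /asboolP aI /asboolP aJ ltIJ.
have [e eJ ne] : exists2 e, e \in J & ~~ conn I (ends e).1 (ends e).2.
  apply/exists_inP; apply: contraTT ltIJ.
  rewrite negb_exists_in -leqNgt => /forall_inP h.
  by apply: acyclic_span_card => // e /h; rewrite negbK.
exists e; last by rewrite inE; apply/asboolP/acyclic_add.
rewrite inE eJ andbT; apply: contra ne => eI.
by apply: connect1; apply/adjP; exists e => //; apply: joins_ends.
Qed.

Definition cycle_matroid : matroid F :=
  Matroid cycle_indep0 cycle_indepS cycle_indep_aug.

End CycleMatroid.

Definition cographic (E : finType) (M : matroid E) :=
  exists G : graph, matroid_iso M (dual (cycle_matroid G)).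

Local Open Scope ring_scope.

Definition matroid_eta (R : realType) (E : finType) (M : matroid E) : R :=
  (rank M + matroid_phi M)%:R / 2.

Definition log2 (R : realType) (x : R) : R := ln x / ln 2.

Definition binary_entropy (R : realType) (x : R) : R :=
  - x * log2 x - (1 - x) * log2 (1 - x).

(* Main.v *)
Require Import Defs.
From mathcomp Require Import boolp classical_sets reals topology normedtype exp.
From mathcomp Require Import all_boot all_order all_algebra.
From mathcomp Require Import ring lra zify.
Import Order.TTheory GRing.Theory Num.Theory.
Import numFieldNormedType.Exports.

(** The bound comes from three facts.

    First, [eta M <= r(M)]: choosing one element in each even lobe of an ear
    decomposition gives an independent set, because a circuit lying in it
    would, at the last lobe it meets, contradict the minimality of that lobe.  Hence [phi M <= r(M)] ([phi_leq_rank]), and it remains to bound the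
    rank by [c0 * mu(M)].

    Second, joins are coset leaders.  Let [M] be the dual of the cycle matroid
    of a graph; its circuits are cuts.  If an edge set [J] is lightest among all
    the symmetric differences of [J] with a cut, then [J] is a join, since
    [#|J + D| = #|J| + #|D| - 2 #|J :&: D|].  Moreover a maximal edge set [T]
    containing no nonempty cut of size at most 2 (one element from each parallel
    class of [M]) contains a lightest member of every coset of the cut space:
    cuts of size 1 or 2 serve to push a lightest member into [T].  The subsets
    of the complement of a maximal forest lie in distinct cosets, so there are
    at least [2 ^ r(M)] cosets, and therefore at least [2 ^ r(M)] subsets of [T]
    of size at most [mu(M)] ([corank_sum_bound], in weighted form).

    Third, [#|T| <= 3 * r(M)] ([cosimple_corank]), by the usual degree count:
    after contraction of the edges outside [T], every vertex with a
    non-loop edge has at least three of them, all in [T].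

    Let [h] be the binary entropy function, [h p = 1/3] with [p < 1/2], and put
    [q = p / (1 - p)].  Weighting a subset [J] of [T] by [q ^ #|J|], the second
    fact gives [2 ^ r * q ^ mu <= (1 + q) ^ #|T|].  After taking logarithms and inserting
    [#|T| <= 3 * r], the equation [h p = 1/3] is exactly what turns this into
    [3 * p * r <= mu].

    The function [h] is strictly increasing on the open interval from 0 to 1/2
    by Gibbs' inequality, which gives the uniqueness of [p]; its existence is
    the intermediate value theorem. *)

Set Implicit Arguments.
Unset Strict Implicit.
Unset Printing Implicit Defensive.

(** * Even lobes and the rank *)

Section EvenLobes.

Variables (E : finType) (M : matroid E).
Implicit Types (C D I J : {set E}) (Cs : seq {set E}).

Lemma dependent_circuit J :
  J \notin indep M -> exists2 C, circuit M C & C \subset J.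
Proof.
move=> dJ; have [C] := @minset_exists _ (fun A => A \notin indep M) J dJ.
by exists C.
Qed.

Lemma circuit_dependent C : circuit M C -> C \notin indep M.
Proof. exact: minsetp. Qed.

Lemma circuit_neq0 C : circuit M C -> C != set0.
Proof. by apply: contraTneq => ->; apply/negP=> /circuit_dependent; rewrite indep0. Qed.

Lemma circuit_antichain C D : circuit M C -> circuit M D -> ~~ (C \proper D).
Proof.
move=> /circuit_dependent dC /minsetP[_ minD]; apply/negP=> /properP[sCD [x xD xC]].
by move: xC; rewrite (minD _ dC sCD) xD.
Qed.

Lemma indep_leq_rank I : I \in indep M -> #|I| <= rank M.
Proof. by move=> iI; apply: (@leq_bigmax_cond _ (fun A => A \in indep M) (fun A => #|A|)). Qed.

Lemma lobe_sub_ear_union Cs i j :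
  i < j -> i < size Cs -> lobe Cs i \subset ear_union Cs j.
Proof.
move=> ij isz; apply: subset_trans (subsetDl _ _) _.
apply/subsetP=> x xi; rewrite /ear_union.
rewrite (big_nth set0) big_mkord; apply/bigcupP.
have lt_i : i < size (take j Cs) by rewrite size_take; case: ifP => //; rewrite (leq_trans ij).
by exists (Ordinal lt_i) => //=; rewrite nth_take.
Qed.

Lemma lobe_disjoint Cs i j x :
  i < size Cs -> j < size Cs -> x \in lobe Cs i -> x \in lobe Cs j -> i = j.
Proof.
move=> si sj xi xj; case: (ltngtP i j) => // h.
  by move: xj; rewrite inE (subsetP (lobe_sub_ear_union h si)).
by move: xi; rewrite inE (subsetP (lobe_sub_ear_union h sj)).
Qed.

Lemma lobe_cover Cs i x : x \in ear_union Cs i -> exists2 j, j < i & x \in lobe Cs j.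
Proof.
elim: i => [|i IH]; first by rewrite /ear_union take0 big_nil inE.
have [xi _|xi] := boolP (x \in ear_union Cs i).
  by have [j ji xj] := IH xi; exists j => //; apply: ltnW.
have [si|si] := ltnP i (size Cs); last first.
  by move: xi; rewrite /ear_union !take_oversize ?(leq_trans si) // => /negbTE->.
rewrite /ear_union (take_nth set0 si) big_rcons /= inE -/(ear_union Cs i) (negbTE xi) ?orbF ?orFb.
by exists i => //; rewrite inE xi.
Qed.

(** A circuit [C] inside [I] would last meet some lobe [i].  Outside the union of
    the earlier ears it would be a proper part of that lobe: this contradicts
    the minimality of the lobe if [C] also meets the earlier ears, and otherwise
    makes [C] a proper part of the [i]-th circuit. *)
Lemma indep_of_partial_lobes Cs I :
  ear_decomposition M Cs ->
  (forall i, i < size Cs -> ~~ (lobe Cs i \subset I)) -> I \in indep M.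
Proof.
move=> [_ /(all_nthP set0) cCs coverCs edCs] nI.
apply: contraT => /dependent_circuit[C cC sCI].
have [x xC] := set0Pn _ (circuit_neq0 cC).
have hasP : exists i, (i < size Cs) && (C :&: lobe Cs i != set0).
  have /lobe_cover[i isz xi] : x \in ear_union Cs (size Cs) by rewrite coverCs inE.
  by exists i; rewrite isz; apply/set0Pn; exists x; rewrite inE xC.
have ub i : (i < size Cs) && (C :&: lobe Cs i != set0) -> i <= size Cs by case/andP=> /ltnW.
case: (ex_maxnP hasP ub) => i /andP[isz ilobe] imax.
have sC : C :\: ear_union Cs i \subset lobe Cs i.
  apply/subsetP=> y; rewrite inE => /andP[yD yC].
  have /lobe_cover[j jsz yj] : y \in ear_union Cs (size Cs) by rewrite coverCs inE.
  have ji : j <= i by apply: imax; rewrite jsz; apply/set0Pn; exists y; rewrite inE yC.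
  have [//|ltji] := eqVneq j i; first by move=> <-.
  move: yD; rewrite (subsetP (lobe_sub_ear_union _ jsz) _ yj) //.
  by rewrite ltn_neqAle ltji.
have pC : C :\: ear_union Cs i \proper lobe Cs i.
  rewrite properE sC; apply: contra (nI i isz) => /subset_trans; apply.
  by apply: subset_trans sCI; apply: subsetDl.
have nC : C :\: ear_union Cs i != set0.
  have [y] := set0Pn _ ilobe; rewrite !inE => /and3P[yC yD _].
  by apply/set0Pn; exists y; rewrite inE yD.
have [C0|C0] := eqVneq (C :&: ear_union Cs i) set0.
  have CE : C :\: ear_union Cs i = C by rewrite -[in RHS](setID C (ear_union Cs i)) C0 set0U.
  rewrite CE in pC; have := circuit_antichain cC (cCs i isz).
  by rewrite (proper_sub_trans pC (subsetDl _ _)).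
have i0 : 0 < i.
  by rewrite lt0n; apply: contraNneq C0 => ->; rewrite /ear_union take0 big_nil setI0.
have := edCs i; rewrite i0 isz => /(_ isT)[_ _ /(_ C cC C0 nC)].
by rewrite pC.
Qed.

(** An even lobe is nonempty, hence has at least two elements, so a single
    element of it never exhausts it. *)
Lemma even_lobes_leq_rank Cs : ear_decomposition M Cs -> even_lobes Cs <= rank M.
Proof.
move=> ed; have [_ /(all_nthP set0) cCs _ edCs] := ed.
have lobe0 i : i < size Cs -> lobe Cs i != set0.
  case: i => [|i] isz; last by have [] := edCs i.+1 isz.
  by rewrite /lobe /ear_union take0 big_nil setD0; apply/circuit_neq0/cCs.
have sz0 : 0 < size Cs by have [] := ed; case: (Cs).
have [x0 _] := set0Pn _ (lobe0 0 sz0).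
pose x i := odflt x0 [pick y in lobe Cs i].
have xP i : i < size Cs -> x i \in lobe Cs i.
  move=> isz; rewrite /x; case: pickP => //= no.
  by have [y yi] := set0Pn _ (lobe0 i isz); have := no y; rewrite /= yi.
pose s := [seq i <- iota 0 (size Cs) | ~~ odd #|lobe Cs i|].
have sP i : i \in s -> i < size Cs /\ ~~ odd #|lobe Cs i|.
  by rewrite mem_filter mem_iota add0n => /and3P[].
have us : uniq (map x s).
  rewrite map_inj_in_uniq ?filter_uniq ?iota_uniq // => i j /sP[si _] /sP[sj _] xij.
  by apply: (@lobe_disjoint Cs _ _ (x i)) => //; [apply: xP | rewrite xij; apply: xP].
rewrite /even_lobes -size_filter -/s -(size_map x) -(card_uniqP us) -(cardsE (mem (map x s))).
apply/indep_leq_rank/(indep_of_partial_lobes ed) => i isz.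
apply/negP=> sI.
have lobe1 : lobe Cs i \subset [set x i].
  apply/subsetP=> y yi; have := subsetP sI y yi; rewrite inE => /mapP[j /sP[sj _] yj].
  by rewrite inE (@lobe_disjoint Cs i j y) ?yj ?xP // -?yj.
have lobe_even : ~~ odd #|lobe Cs i|.
  have := subsetP sI _ (xP i isz); rewrite inE => /mapP[j /sP[sj oj] xij].
  by rewrite (@lobe_disjoint Cs i j (x i)) ?xP // xij xP.
have := subset_leq_card lobe1; rewrite cards1.
have := lobe0 i isz; rewrite -card_gt0.
by case: #|_| lobe_even => [|[|]].
Qed.

Lemma phi_leq_rank : matroid_phi M <= rank M.
Proof.
have [edM|ned] := pselect (exists Cs, ear_decomposition M Cs).
  by have [[Cs ed <-] _] := matroid_phiP edM; apply: even_lobes_leq_rank.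
rewrite /matroid_phi; case: pselect => [h|//].
by case: ned; case: h => k /asboolP[Cs ed _]; exists Cs.
Qed.

End EvenLobes.

(** * Symmetric differences *)

Section SymDiff.

Variable T : finType.
Implicit Types A B C : {set T}.

Definition symdiff A B := [set x | (x \in A) (+) (x \in B)].

Lemma in_symdiff A B x : (x \in symdiff A B) = (x \in A) (+) (x \in B).
Proof. by rewrite inE. Qed.

Lemma symdiffA A B C : symdiff A (symdiff B C) = symdiff (symdiff A B) C.
Proof. by apply/setP=> x; rewrite !inE addbA. Qed.

Lemma symdiffK A B : symdiff (symdiff A B) B = A.
Proof. by apply/setP=> x; rewrite !inE addbK. Qed.

Lemma card_symdiff A B : #|symdiff A B| + 2 * #|A :&: B| = #|A| + #|B|.
Proof.
have -> : symdiff A B = (A :\: B) :|: (B :\: A).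
  by apply/setP=> x; rewrite !inE; case: (x \in A); case: (x \in B).
have dj : [disjoint A :\: B & B :\: A].
  by rewrite -setI_eq0; apply/eqP/setP=> x; rewrite !inE; case: (x \in A); case: (x \in B).
have := cardsID B A; have := cardsID A B; rewrite [B :&: A]setIC.
move: (leq_card_setU (A :\: B) (B :\: A)); rewrite dj => -[_ /eqP->]; lia.
Qed.

End SymDiff.

(** * Cuts of a graph and joins of the dual of its cycle matroid *)

Section Cuts.

Variable G : graph.
Notation V := (vertex G).
Notation F := (edge G).
Notation N := (dual (cycle_matroid G)).
Implicit Types (X Y : {set V}) (A B C I J T S : {set F}) (e f : F) (x y : V).

Definition cut X : {set F} := [set e | ((ends e).1 \in X) (+) ((ends e).2 \in X)].

(** The vertices contracted together with [x] when the edges of [A] are. *)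
Definition comp A x : {set V} := [set y | connect (adj A) x y].

Lemma cut_symdiff X Y : cut (symdiff X Y) = symdiff (cut X) (cut Y).
Proof. by apply/setP=> e; rewrite !inE addbACA. Qed.

Lemma cut_joins X e x y : joins e x y -> (e \in cut X) = (x \in X) (+) (y \in X).
Proof. by rewrite inE /joins => /orP[]/eqP-> //=; rewrite addbC. Qed.

Lemma connect_cut X A x y :
  [disjoint A & cut X] -> connect (adj A) x y -> (x \in X) = (y \in X).
Proof.
move=> dAX; apply: closed_connect => a b /adjP[e eA je].
have := disjointFr dAX eA; rewrite (cut_joins X je).
by case: (a \in X); case: (b \in X).
Qed.

Lemma cut_comp_disjoint A x : [disjoint A & cut (comp A x)].
Proof.
rewrite disjoint_subset; apply/subsetP=> e eA; rewrite !inE addbC -negb_eqb negbK.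
have ce : connect (adj A) (ends e).1 (ends e).2.
  by apply: connect1; apply/adjP; exists e => //; apply: joins_ends.
apply/eqP; apply/idP/idP => h; apply: connect_trans h _ => //; by rewrite conn_sym.
Qed.

Lemma cut_comp_end A e : ~~ connect (adj A) (ends e).1 (ends e).2 ->
  e \in cut (comp A (ends e).1).
Proof. by move=> /negbTE ne; rewrite !inE connect0 ne. Qed.

Lemma base_acyclic B : base (cycle_matroid G) B -> acyclic B.
Proof. by move=> /maxsetp; rewrite inE => /asboolP. Qed.

Lemma base_spans B e :
  base (cycle_matroid G) B -> connect (adj B) (ends e).1 (ends e).2.
Proof.
move=> bB; apply: contraT => ne.
have aeB : e |: B \in indep (cycle_matroid G).
  by rewrite inE; apply/asboolP/acyclic_add => //; apply: base_acyclic.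
have eB : e \in B.
  by case/maxsetP: (bB) => _ maxB; rewrite -(maxB _ aeB (subsetUr _ _)) setU11.
by case/negP: ne; apply: connect1; apply/adjP; exists e => //; apply: joins_ends.
Qed.

Lemma cut_meets_base B X :
  base (cycle_matroid G) B -> [disjoint B & cut X] -> cut X = set0.
Proof.
move=> bB dBX; apply/setP=> e; rewrite !inE.
by rewrite (connect_cut dBX (base_spans e bB)) addbb.
Qed.

(** For a single edge [e] of the forest, the component of one end of [e] in the
    forest without [e] is bounded by a cut that meets the forest in [e] only;
    sums of these cuts realise every trace. *)
Lemma cut_trace B A : acyclic B -> A \subset B -> exists X, cut X :&: B = A.
Proof.
move=> aB; have [n] := ubnP #|A|; elim: n A => // n IH A ltA sAB.
have [->|[e eA]] := set_0Vmem A.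
  by exists set0; apply/setP=> e; rewrite !inE.
have eB := subsetP sAB e eA.
have [|X XA] := IH (A :\ e) _ (subset_trans (subsetDl _ _) sAB).
  by move: ltA; rewrite (cardsD1 e A) eA.
pose Y := comp (B :\ e) (ends e).1.
have eY : e \in cut Y by apply/cut_comp_end/acyclic_del.
have dY f : f \in B -> f \in cut Y = (f == e).
  move=> fB; have [->//|fe] := eqVneq f e.
  by apply: (disjointFr (cut_comp_disjoint (B :\ e) _)); rewrite !inE fe.
exists (symdiff X Y); rewrite cut_symdiff; apply/setP=> f.
move/setP/(_ f): XA; rewrite !in_setI in_symdiff in_setD1.
have [fB|fB] := boolP (f \in B); last first.
  by rewrite !andbF => _; apply/esym/negbTE/(contra _ fB)/subsetP.
rewrite dY // !andbT => ->; have [->|] := eqVneq f e; first by rewrite eA.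
by rewrite addbF.
Qed.

(** For a maximal acyclic subset: an edge of [A] whose ends it did not connect
    could be added to it. *)
Lemma acyclic_spanning A : exists I, [/\ acyclic I, I \subset A &
  forall e, e \in A -> connect (adj I) (ends e).1 (ends e).2].
Proof.
pose P I := (I \in indep (cycle_matroid G)) && (I \subset A).
have P0 : P set0 by rewrite /P indep0 sub0set.
have [I /maxsetP[/andP[iI sIA] maxI] _] := maxset_exists P0.
have aI : acyclic I by move: iI; rewrite inE => /asboolP.
exists I; split=> // e eA; apply: contraT => ne.
have PeI : P (e |: I).
  by rewrite /P subUset sub1set eA sIA !andbT inE; apply/asboolP/acyclic_add.
case/negP: (ne); apply: connect1; apply/adjP; exists e; last exact: joins_ends.
by rewrite -(maxI _ PeI (subsetUr _ _)) setU11.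
Qed.

(** The complement of a cocircuit [C] does not span, so it fails to connect the
    two ends of some edge; the component of one of them is bounded by a nonempty
    cut inside [C], which is codependent and thus equals [C]. *)
Lemma cocircuit_cut C : circuit N C -> exists X, C = cut X.
Proof.
move=> cC; have dC := circuit_dependent cC.
suff [e ne] : exists e, ~~ connect (adj (~: C)) (ends e).1 (ends e).2.
  exists (comp (~: C) (ends e).1); apply/esym.
  case/minsetP: cC => _; apply.
    rewrite inE; apply/negP=> /existsP[B /andP[bB sB]].
    have := cut_comp_end ne; rewrite (cut_meets_base bB) ?inE //.
    by rewrite disjoint_sym disjoints_subset.
  by have := cut_comp_disjoint (~: C) (ends e).1; rewrite disjoint_sym disjoints_subset setCK.
apply/existsP; apply: contraNT dC; rewrite negb_exists => /forallP sp.
have [I [aI sIC spI]] := acyclic_spanning (~: C).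
rewrite inE; apply/existsP; exists I.
rewrite -disjoints_subset disjoint_sym disjoints_subset sIC andbT.
apply/maxsetP; split=> [|J]; rewrite inE; first exact/asboolP.
move=> /asboolP aJ sIJ; apply/eqP; rewrite eq_sym eqEcard sIJ.
apply: acyclic_span_card => // e _.
by have := sp e; rewrite negbK; apply: conn_sub spI _ _.
Qed.

Lemma corankE B : base (cycle_matroid G) B -> rank N = #|~: B|.
Proof.
move=> bB; apply/eqP; rewrite eqn_leq; apply/andP; split; last first.
  apply: indep_leq_rank; rewrite inE; apply/existsP; exists B; by rewrite bB subxx.
apply/bigmax_leqP=> I; rewrite inE => /existsP[B' /andP[bB' sI]].
apply: leq_trans (subset_leq_card sI) _.
have : #|B| <= #|B'| by apply: (base_card_max (M := cycle_matroid G)) => //; case/maxsetP: bB.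
by have := cardsC B; have := cardsC B'; lia.
Qed.

(** The sets on which the dual restricts to a simple matroid, its loops and
    parallel pairs being cuts of size 1 and 2. *)
Definition cosimple T :=
  [forall X, (cut X \subset T) ==> (#|cut X| <= 2) ==> (cut X == set0)].

Definition lightest J := [forall X, #|J| <= #|symdiff J (cut X)|].

Lemma lightest_join J : lightest J -> join N J.
Proof.
move=> /forallP lJ; apply/forall_inP=> C /cocircuit_cut[X ->].
by have := lJ X; have := card_symdiff J (cut X); lia.
Qed.

(** Minimize first the size, then the number of elements outside [T].  If an
    element [e] outside [T] remained in [J], the maximality of [T] would provide
    a cut of size at most 2 consisting of [e] and possibly an element of [T].
    Adding it to [J] removes [e] and inserts at most one element of [T]. *)
Lemma lightest_exists T A : maxset cosimple T ->
  exists J X, [/\ J = symdiff A (cut X), lightest J & J \subset T].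
Proof.
move=> /maxsetP[cT maxT].
pose J X := symdiff A (cut X).
(* the factor [#|F|.+1] makes the comparison of weights lexicographic *)
pose w B := #|F|.+1 * #|B| + #|B :\: T|.
have [X _ minX] := @arg_minnP _ set0 predT (fun X => w (J X)) isT.
have {}minX Y : w (J X) <= w (symdiff (J X) (cut Y)).
  by rewrite /J -symdiffA -cut_symdiff; apply: minX.
exists (J X), X; split=> //; move: (J X) minX => {}J minJ.
  apply/forallP=> Y; have := minJ Y; rewrite /w.
  by have := subset_leq_card (subsetT (symdiff J (cut Y) :\: T)); rewrite cardsT; nia.
apply/subsetP=> e eJ; apply: contraT => eT.
have [Y [sY leY nY]] : exists Y, [/\ cut Y \subset e |: T, #|cut Y| <= 2 & cut Y != set0].
  have : ~~ cosimple (e |: T).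
    by apply: contra eT => /maxT/(_ (subsetUr _ _)) <-; rewrite setU11.
  rewrite negb_forall => /existsP[Y]; rewrite !negb_imply => /and3P[? ? ?].
  by exists Y.
have eY : e \in cut Y.
  apply: contraT => eY; have := forallP cT Y; rewrite leY (negbTE nY) /= implybF.
  case/negP; apply/subsetP=> f fY.
  have := subsetP sY f fY; rewrite !inE => /orP[/eqP fe|//].
  by rewrite -fe fY in eY.
have := minJ Y; rewrite /w leqNgt => /negP[].
have := card_symdiff J (cut Y).
have le1 : 0 < #|J :&: cut Y| by apply/card_gt0P; exists e; rewrite inE eJ.
have lt2 : #|symdiff J (cut Y) :\: T| < #|J :\: T|.
  apply: proper_card; apply/properP; split; last first.
    by exists e; rewrite !in_setD ?in_symdiff eT eJ ?eY.
  apply/subsetP=> f; rewrite !in_setD in_symdiff => /andP[fT]; rewrite fT.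
  have [fY|fY] := boolP (f \in cut Y); last by rewrite addbF.
  by have := subsetP sY f fY; rewrite in_setU1 (negbTE fT) orbF => /eqP->; rewrite eJ.
nia.
Qed.

(** Two subsets of the complement of a base that differ by a cut are equal, since
    that cut avoids the base.  The map that sends such a subset to a lightest
    member of its coset inside [T] is therefore injective, and each value is a
    join, of weight at least [q ^+ mu]. *)
Lemma corank_sum_bound (R : numDomainType) (q : R) T :
  maxset cosimple T -> (0 <= q <= 1)%R ->
  (2 ^+ rank N * q ^+ matroid_mu N <= \sum_(J in powerset T) q ^+ #|J|)%R.
Proof.
move=> mT /andP[q0 q1].
have [B bB _] := maxset_exists (indep0 (cycle_matroid G)).
rewrite (corankE bB).
have /choice[lead leadP] := fun A => lightest_exists A mT.
have inj : {in powerset (~: B) &, injective lead}.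
  move=> A A'; rewrite !inE => /subsetP sA /subsetP sA' eqJ.
  have [X [eJ _ _]] := leadP A; have [X' [eJ' _ _]] := leadP A'.
  have eXX' : cut (symdiff X X') = set0.
    apply: (cut_meets_base bB); rewrite disjoint_subset; apply/subsetP=> e eB.
    have nA (D : {set F}) : {subset D <= ~: B} -> e \notin D.
      by move=> sD; apply/negP=> /sD; rewrite inE eB.
    move/setP/(_ e): eqJ; rewrite eJ eJ' !in_symdiff (negbTE (nA _ sA)) (negbTE (nA _ sA')) /=.
    by rewrite [_ \in [predC _]]inE cut_symdiff in_symdiff => ->; rewrite addbb.
  have eX : cut X = cut X'.
    apply/setP=> e; move/setP/(_ e): eXX'.
    by rewrite cut_symdiff in_symdiff in_set0; case: (_ \in _); case: (_ \in _).
  by rewrite -(symdiffK A (cut X)) -eJ eqJ eJ' eX symdiffK.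
apply: (@le_trans _ _ (\sum_(A in powerset (~: B)) q ^+ #|lead A|)%R).
  rewrite -natrX -card_powerset mulrC mulr_natr -sumr_const.
  apply: ler_sum => A _; apply: ler_wiXn2l => //.
  have [X [_ lJ _]] := leadP A.
  by apply: (@leq_bigmax_cond _ (fun J => join N J) (fun J => #|J|)); apply: lightest_join.
rewrite -(big_imset (fun J => q ^+ #|J|)%R inj) /=.
rewrite [X in (_ <= X)%R](bigID (mem (lead @: powerset (~: B)))) /=.
rewrite -[X in (X <= _)%R]addr0 lerD //; last by apply: sumr_ge0 => J _; apply: exprn_ge0.
rewrite le_eqVlt; apply/orP; left; apply/eqP; apply: eq_bigl => J.
rewrite andbC; apply/idP/andP => [|[]//] JA; split=> //.
by case/imsetP: JA => A _ ->; rewrite inE; have [X []] := leadP A.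
Qed.

(** The vertices of nonzero, non-loop degree in the graph where [S] is
    contracted. *)
Definition pieces S : {set {set V}} :=
  [set K in [set comp S x | x : V] | cut K != set0].

Lemma comp_eq S x y : y \in comp S x -> comp S x = comp S y.
Proof.
rewrite inE => xy; apply/setP=> z; rewrite !inE.
apply/idP/idP => [xz|]; last exact: connect_trans.
by apply: connect_trans xz; rewrite conn_sym.
Qed.

Lemma comp_sub S X x : [disjoint S & cut X] -> (comp S x \subset X) = (x \in X).
Proof.
move=> dSX; apply/idP/idP => [/subsetP|xX]; first by apply; rewrite inE connect0.
by apply/subsetP=> y; rewrite inE => /(connect_cut dSX) <-.
Qed.

Lemma cut_piece S K e : K \in pieces S -> e \in cut K ->
  K = comp S (ends e).1 \/ K = comp S (ends e).2.
Proof.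
rewrite inE => /andP[/imsetP[x _ ->] _].
rewrite inE; case: (boolP (_ \in comp S x)) => [/comp_eq|_ /comp_eq]; by [left | right].
Qed.

(** A cut that avoids [S] is the boundary of a union of [S]-components, and the
    components bounded by an empty cut do not contribute to it. *)
Lemma cut_by_pieces S X X' : [disjoint S & cut X] -> [disjoint S & cut X'] ->
  [set K in pieces S | K \subset X] = [set K in pieces S | K \subset X'] ->
  cut X = cut X'.
Proof.
move=> dX dX' eXX'; apply/setP=> e.
have [ce|ce] := boolP (connect (adj S) (ends e).1 (ends e).2).
  by rewrite !inE (connect_cut dX ce) (connect_cut dX' ce) !addbb.
have end_piece x : e \in cut (comp S x) -> (x \in X) = (x \in X').
  move=> ex; move/setP/(_ (comp S x)): eXX'; rewrite !in_set imset_f //.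
  have -> : cut (comp S x) != set0 by apply/set0Pn; exists e.
  by rewrite !comp_sub.
have e2 : e \in cut (comp S (ends e).2) by rewrite !inE connect0 conn_sym (negbTE ce).
by rewrite !inE (end_piece _ (cut_comp_end ce)) (end_piece _ e2).
Qed.

(** Double counting of the pairs of a piece and an edge leaving it: cosimplicity
    puts at least three edges at each piece, and an edge leaves at most two. *)
Lemma cosimple_pieces T : cosimple T -> 3 * #|pieces (~: T)| <= 2 * #|T|.
Proof.
move=> /forallP cT; set S := ~: T.
have sT K : K \in pieces S -> cut K \subset T.
  rewrite inE => /andP[/imsetP[x _ ->] _].
  by have := cut_comp_disjoint S x; rewrite disjoint_sym disjoints_subset setCK.
have ge3 K : K \in pieces S -> 3 <= #|cut K|.
  move=> KP; have := cT K; rewrite sT //=.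
  by move: KP; rewrite inE => /andP[_ /negbTE->]; rewrite implybF -ltnNge.
rewrite [3 * _]mulnC [2 * _]mulnC -!sum_nat_const.
apply: leq_trans (leq_sum _ ge3) _.
under eq_bigr => K KP do rewrite -sum1_card.
rewrite (exchange_big_dep (mem T)) /= => [|K e KP]; last exact/subsetP/sT.
apply: leq_sum => e eT; rewrite sum1dep_card.
apply: leq_trans (_ : #|[set comp S (ends e).1; comp S (ends e).2]| <= _).
  apply/subset_leq_card/subsetP=> K; rewrite inE => /andP[KP eK].
  by rewrite !inE; case: (cut_piece KP eK) => ->; rewrite eqxx ?orbT.
by rewrite cards2; case: eqP.
Qed.

(** In a base [B] containing a maximal acyclic part of the complement of [T], the
    rest [B :&: T] is a forest of the contracted graph.  It has at most as many
    edges as there are pieces: its subsets are traces of cuts that avoid the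
    complement of [T], and those are determined by sets of pieces.  So the rank
    is at least [#|T| - #|pieces|], while [3 * #|pieces| <= 2 * #|T|]. *)
Lemma cosimple_corank T : cosimple T -> #|T| <= 3 * rank N.
Proof.
move=> cT; pose S := ~: T.
have [I [aI sIS spI]] := acyclic_spanning S.
have iI : I \in indep (cycle_matroid G) by rewrite inE; apply/asboolP.
have [B /= bB sIB] := maxset_exists iI.
have /choice[X XP] : forall A, exists X, A \subset B -> cut X :&: B = A.
  move=> A; have [sAB|nAB] := boolP (A \subset B); last by exists set0.
  by have [X XA] := cut_trace (base_acyclic bB) sAB; exists X.
have dX A : A \subset B :&: T -> [disjoint S & cut (X A)].
  rewrite subsetI => /andP[sAB sAT].
  have dI : [disjoint I & cut (X A)].
    rewrite disjoint_subset; apply/subsetP=> e eI; rewrite inE; apply/negP=> eX.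
    have : e \in A by rewrite -(XP A sAB) inE eX (subsetP sIB).
    by move/(subsetP sAT); have := subsetP sIS e eI; rewrite inE => /negbTE->.
  rewrite disjoint_subset; apply/subsetP=> e eS.
  by rewrite !inE (connect_cut dI (spI e eS)) addbb.
have leK : #|B :&: T| <= #|pieces S|.
  rewrite -(leq_exp2l (m := 2)) // -!card_powerset.
  rewrite -(card_in_imset (f := fun A => [set K in pieces S | K \subset X A])).
    apply/subset_leq_card/subsetP=> _ /imsetP[A _ ->].
    by rewrite inE; apply/subsetP=> K; rewrite inE => /andP[].
  move=> A A'; rewrite !inE => sA sA' /(cut_by_pieces (dX A sA) (dX A' sA')) eX.
  have sub (D : {set F}) : D \subset B :&: T -> D \subset B by rewrite subsetI => /andP[].
  by rewrite -(XP A (sub A sA)) eX XP // sub.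
rewrite (corankE bB).
have := cosimple_pieces cT; rewrite -/S.
have := cardsID T B; have := subset_leq_card (subsetDr B T : B :\: T \subset ~: T).
by have := cardsC B; have := cardsC T; lia.
Qed.

End Cuts.

(** * Invariance under isomorphism *)

Section Isomorphism.

Variables (E1 E2 : finType) (M1 : matroid E1) (M2 : matroid E2).
Hypothesis iso : matroid_iso M1 M2.

Lemma iso_leq_rank : rank M1 <= rank M2.
Proof.
have [f /bij_inj injf fE] := iso.
apply/bigmax_leqP=> I iI; rewrite -(card_imset _ injf).
by apply: indep_leq_rank; rewrite fE.
Qed.

Lemma iso_leq_mu : matroid_mu M2 <= matroid_mu M1.
Proof.
have [f [g fK gK] fE] := iso; have injf := can_inj fK.
apply/bigmax_leqP=> J jJ.
have imJ : f @: (f @^-1: J) = J.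
  apply/setP=> y; apply/imsetP/idP => [[x + ->]|yJ]; first by rewrite inE.
  by exists (g y); rewrite ?inE gK.
rewrite -imJ (card_imset _ injf).
apply: (@leq_bigmax_cond _ (fun J => join M1 J) (fun J => #|J|)).
apply/forall_inP=> C cC.
have cfC : circuit M2 (f @: C).
  case/minsetP: cC => dC minC; apply/minsetP; split=> [|D dD sD]; first by rewrite fE.
  have DE : D = f @: (f @^-1: D).
    apply/setP=> y; apply/idP/imsetP => [yD|[x + ->]]; last by rewrite inE.
    by exists (g y); rewrite ?inE gK.
  rewrite DE (minC (f @^-1: D)) //; first by rewrite -fE -DE.
  apply/subsetP=> x; rewrite inE => /(subsetP sD) /imsetP[z zC fxz].
  by rewrite (injf _ _ fxz).
have := forall_inP jJ _ cfC; rewrite (card_imset _ injf).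
suff -> : J :&: f @: C = f @: (f @^-1: J :&: C) by rewrite (card_imset _ injf).
by rewrite imsetI ?imJ // => x y _ _; apply: injf.
Qed.

End Isomorphism.

Local Open Scope ring_scope.

(** * The binary entropy function *)

Section Entropy.

Variable R : realType.
Implicit Types p q : R.

Lemma ln2_ge_half : 1 / 2 <= ln 2 :> R.
Proof.
have h : -1 < (- (1 / 2) : R) by lra.
have := le_ln1Dx h; have -> : 1 + - (1 / 2) = 2^-1 :> R by lra.
by rewrite lnV ?posrE //; lra.
Qed.

Lemma binary_entropyE p :
  binary_entropy p = (- p * ln p - (1 - p) * ln (1 - p)) / ln 2.
Proof. by rewrite /binary_entropy /log2; field; have := ln2_ge_half; lra. Qed.

(** Sum of [x * (ln y - ln x) <= y - x] over the two outcomes. *)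
Lemma gibbs p q : 0 < p < 1 -> 0 < q < 1 ->
  - p * ln p - (1 - p) * ln (1 - p) <= - p * ln q - (1 - p) * ln (1 - q).
Proof.
have step (x y : R) : 0 < x -> 0 < y -> x * (ln y - ln x) <= y - x.
  move=> x0 y0; rewrite -ln_div ?posrE //.
  have h : -1 < y / x - 1 by have := divr_gt0 y0 x0; lra.
  have := le_ln1Dx h; rewrite addrC subrK => le.
  apply: le_trans (_ : x * (y / x - 1) <= _); first by rewrite ler_pM2l.
  by rewrite le_eqVlt; apply/orP; left; apply/eqP; field; lra.
move=> p01 q01.
have := step p q; have := step (1 - p) (1 - q).
by nra.
Qed.

(** By Gibbs' inequality [h p] is at most the value at [p] of the tangent to [h]
    at [q], an affine function that increases because [q < 1/2]. *)
Lemma entropy_lt p q : 0 < p -> p < q -> q < 1 / 2 ->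
  binary_entropy p < binary_entropy q.
Proof.
move=> p0 pq q12; rewrite !binary_entropyE ltr_pM2r ?invr_gt0; last by have := ln2_ge_half; lra.
have := @gibbs p q.
have : ln q < ln (1 - q) by rewrite ltr_ln ?posrE; lra.
by nra.
Qed.

(** [h (1/2) = 1], while [h (1/32) < 1/3] already follows from [1/2 <= ln 2] and
    [ln (32/31) <= 1/31]. *)
Lemma entropy_third :
  exists2 p : R, 0 < p < 1 / 2 & binary_entropy p = 1 / 3.
Proof.
have ln2 := ln2_ge_half.
have h12 : binary_entropy (1 / 2 : R) = 1.
  rewrite binary_entropyE; have -> : 1 - 1 / 2 = 2^-1 :> R by lra.
  by rewrite div1r lnV ?posrE //; field; lra.
have h32 : binary_entropy (1 / 32 : R) < 1 / 3.
  rewrite binary_entropyE.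
  have ln32 : ln (1 / 32) = - (5 * ln 2) :> R.
    rewrite (_ : 1 / 32 = (2 ^+ 5)^-1 :> R); last by field.
    by rewrite lnV ?posrE ?exprn_gt0 // lnXn // mulr_natl.
  have ln3132 : ln (1 - 1 / 32) = - ln (32 / 31) :> R.
    by rewrite (_ : 1 - 1 / 32 = (32 / 31)^-1 :> R) ?lnV ?posrE ?divr_gt0 //; field.
  have le : ln (32 / 31) <= 1 / 31 :> R.
    have h : -1 < (1 / 31 : R) by lra.
    by have := le_ln1Dx h; congr (ln _ <= _); field.
  by rewrite ltr_pdivrMr ?ln32 ?ln3132; lra.
have cont : {within `[1 / 32, 1 / 2], continuous (@binary_entropy R)}%classic.
  apply: continuous_in_subspaceT => x /set_mem; rewrite /= in_itv /= => /andP[x1 x2].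
  have c1 : (ln y @[y --> x] --> ln x)%classic by apply: continuous_ln; lra.
  have c2 : (ln (1 - y) @[y --> x] --> ln (1 - x))%classic.
    apply: (@continuous_comp _ _ _ (fun y : R => 1 - y) (@ln R)).
      by apply: cvgB; [apply: cvg_cst | apply: cvg_id].
    by apply: continuous_ln; lra.
  apply: cvgB.
    apply: cvgM; first by apply: cvgN; apply: cvg_id.
    by apply: cvgMl.
  apply: cvgM; first by apply: cvgB; [apply: cvg_cst | apply: cvg_id].
  by apply: cvgMl.
have le : 1 / 32 <= 1 / 2 :> R by lra.
have [|p] := @IVT _ _ _ _ (1 / 3) le cont.
  by rewrite h12 minElt maxElt; case: ifP; lra.
rewrite in_itv /= => /andP[p1 p2] hp; exists p => //.
have p12 : p != 1 / 2 by apply/eqP=> e; move: hp; rewrite e h12; lra.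
by move: p2; rewrite le_eqVlt (negbTE p12) /=; lra.
Qed.

End Entropy.

Section WeightedCount.

Variable R : realType.

Lemma sum_powerset_expr (F : finType) (T : {set F}) (q : R) :
  \sum_(J in powerset T) q ^+ #|J| = (q + 1) ^+ #|T|.
Proof.
rewrite exprD1n (partition_big (fun J : {set F} => inord #|J| : 'I_#|T|.+1) predT) //=.
apply: eq_bigr => i _; rewrite (eq_bigl (mem [set J : {set F} | J \subset T & #|J| == i])).
  rewrite (eq_bigr (fun=> q ^+ i)) => [|J]; last by rewrite [_ J]inE => /andP[_ /eqP->].
  by rewrite sumr_const cards_draws.
move=> J; rewrite !inE /=; have [sJ|//] := boolP (J \subset T).
by rewrite -val_eqE /= inordK // ltnS subset_leq_card.
Qed.

(** The first hypothesis reads [c - 3 * L = 3 * p * K] for [L = - b] and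
    [K = b - a], so the last one, where [t <= 3 * r], becomes
    [3 * p * K * r <= K * m].  Here [a], [b] and [c] stand for [ln p], [ln (1 - p)] and [ln 2]. *)
Lemma entropy_arith (a b c p r t m : R) :
  - p * a - (1 - p) * b = 1 / 3 * c -> a < b -> b <= 0 -> t <= 3 * r ->
  c * r + (a - b) * m <= - b * t -> 3 * p * r <= m.
Proof.
move=> hp ab b0 tr H.
have {H} : c * r + (a - b) * m <= - b * (3 * r).
  by apply: le_trans H _; rewrite ler_wpM2l // oppr_ge0.
have -> : c = 3 * p * (b - a) - 3 * b by lra.
move=> H; rewrite -(@ler_pM2r _ (b - a)) ?subr_gt0 // -subr_ge0.
move: H; rewrite -subr_ge0; congr (0 <= _); ring.
Qed.

Lemma entropy_bound (p : R) (r t m : nat) :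
  0 < p < 1 / 2 -> binary_entropy p = 1 / 3 -> (t <= 3 * r)%N ->
  let q := p / (1 - p) in 2 ^+ r * q ^+ m <= (q + 1) ^+ t ->
  3 * p * r%:R <= m%:R.
Proof.
move=> p01 hp t3r q.
have ln2 := @ln2_ge_half R.
have q0 : 0 < q by apply: divr_gt0; lra.
have q1E : q + 1 = (1 - p)^-1 by rewrite /q; field; lra.
rewrite q1E => le.
have : ln (2 ^+ r * q ^+ m) <= ln ((1 - p)^-1 ^+ t).
  by rewrite ler_ln ?posrE ?mulr_gt0 ?exprn_gt0 ?invr_gt0 //; lra.
rewrite lnM ?posrE ?exprn_gt0 //.
have p1 : 0 < 1 - p by lra.
rewrite !lnXn ?invr_gt0 // lnV ?posrE // ln_div ?posrE //; last lra.
move: hp; rewrite binary_entropyE => /(congr1 (fun x => x * ln 2)).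
rewrite mulfVK; last by apply/eqP; lra.
move=> hp.
have K : ln p < ln (1 - p) by rewrite ltr_ln ?posrE; lra.
have L : ln (1 - p) <= 0.
  have p_gtN1 : -1 < - p by lra.
  by have := le_ln1Dx p_gtN1; lra.
have t3 : t%:R <= 3 * r%:R :> R by rewrite -natrM ler_nat.
rewrite -(mulr_natr (ln 2)) -(mulr_natr (ln p - _)) -(mulr_natr (- ln _)).
exact: entropy_arith.
Qed.

End WeightedCount.

(** * The bound for cographic matroids *)

Lemma cographic_rank_bound (R : realType) (p : R) (E : finType) (M : matroid E) :
  0 < p < 1 / 2 -> binary_entropy p = 1 / 3 -> cographic M ->
  3 * p * (rank M)%:R <= (matroid_mu M)%:R.
Proof.
move=> p01 hp [G iso].
have [T mT _] : {T | maxset (@cosimple G) T & set0 \subset T}.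
  apply: maxset_exists; apply/forallP=> X.
  by rewrite subset0; case: eqP => //= _; rewrite implybT.
have cT := maxsetp mT.
have q01 : 0 <= p / (1 - p) <= 1.
  by rewrite divr_ge0 ?ler_pdivrMr /=; lra.
have := corank_sum_bound mT q01; rewrite sum_powerset_expr.
move=> /(entropy_bound p01 hp (cosimple_corank cT)) le.
apply: le_trans (_ : (matroid_mu (dual (cycle_matroid G)))%:R <= _); last first.
  by rewrite ler_nat iso_leq_mu.
apply: le_trans le; rewrite ler_wpM2l ?ler_nat ?iso_leq_rank //; lra.
Qed.

Theorem theorem5p2 (R : realType) :
  exists2 alpha0 : R,
    unique (fun a : R => 0 < a < 1 / 2 /\ binary_entropy a = 1 / 3) alpha0 &
    forall (E : finType) (M : matroid E),
      matroid_connected M -> cographic M -> ~ matroid_iso M (uniform 1 1) ->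
      let c0 : R := 1 / (3 * alpha0) in
      matroid_eta R M <= c0 * (matroid_mu M)%:R.
Proof.
have [p p01 hp] := @entropy_third R; exists p.
  split=> // a [a01 ha]; case: (ltgtP p a) => // [pa|ap].
    by have := @entropy_lt _ p a; lra.
  by have := @entropy_lt _ a p; lra.
move=> E M _ cM _ /=.
have p0 : 0 < 3 * p by lra.
apply: le_trans (_ : (rank M)%:R <= _).
  rewrite /matroid_eta ler_pdivrMr ?ltr0n // -natrM ler_nat.
  by have := phi_leq_rank M; lia.
by rewrite mulrC div1r ler_pdivlMr // mulrC cographic_rank_bound.
Qed.
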